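(* Let $\mathbf X\in\mathbb R^{n\times p}$ be deterministic with columns satisfying $\|\boldsymbol x^j\|_2^2\le n$, $\boldsymbol\beta^*\in\mathbb R^p$, $\sigma^*>0$, and $\boldsymbol y=\mathbf X\boldsymbol\beta^*+\boldsymbol\xi$ with $\boldsymbol\xi\sim\mathcal N_n(0,\sigma^{*2}\mathbf I_n)$. Let $T\subset[p]$ be a set of indices and let $\delta>0$, $\gamma\ge1$ be constants. If the tuning parameter $\lambda>0$ is not smaller than $\gamma\sigma^*\rho_T\sqrt{2\log(p/\delta)/n}$, then the Lasso $\widehat{\boldsymbol\beta}_\lambda$ fulfills $$\ell_n(\widehat{\boldsymbol\beta}_\lambda,\boldsymbol\beta^* )+\frac{2(\gamma-1)\lambda}{\gamma}\|\widehat{\boldsymbol\beta}_\lambda\|_1\le\inf_{\bar{\boldsymbol\beta}\in\mathbb R^p}\Big\{\ell_n(\bar{\boldsymbol\beta},\boldsymbol\beta^* )+\frac{2(\gamma+1)\lambda}{\gamma}\|\bar{\boldsymbol\beta}\|_1\Big\}+\frac{2\sigma^{*2}(|T|+2\log(1/\delta))}{n}$$ with probability at least $1-2\delta$.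
   Context: $[p]=\{1,\dots,p\}$. $\widehat{\boldsymbol\beta}_\lambda$ is any element of $\arg\min_{\boldsymbol\beta\in\mathbb R^p}\{\frac1{2n}\|\boldsymbol y-\mathbf X\boldsymbol\beta\|_2^2+\lambda\|\boldsymbol\beta\|_1\}$. The prediction loss is $\ell_n(\boldsymbol\beta,\boldsymbol\beta')=\frac1n\|\mathbf X(\boldsymbol\beta-\boldsymbol\beta')\|_2^2$. $\Pi_T$ is the orthogonal projector of $\mathbb R^n$ onto the span of $\{\boldsymbol x^j:j\in T\}$, where $\boldsymbol x^j$ is the $j$-th column of $\mathbf X$, and $\rho_T=n^{-1/2}\max_{j\in[p]}\|(\mathbf I_n-\Pi_T)\boldsymbol x^j\|_2$. *)

(* Defs.v *)
From HB Require Import structures.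
From mathcomp Require Import all_boot all_order all_algebra.
From mathcomp Require Import all_classical all_reals all_analysis.

Set Implicit Arguments.
Unset Strict Implicit.
Unset Printing Implicit Defensive.

Import Order.TTheory GRing.Theory Num.Theory.
Import numFieldNormedType.Exports.

Local Open Scope classical_set_scope.
Local Open Scope ring_scope.

Section Euclidean.
Context {R : realType}.

Definition dot n (u v : 'cV[R]_n) : R := \sum_(i < n) u i 0 * v i 0.

(* The library norm `|v| on matrices is the sup norm. *)
Definition l1norm n (v : 'cV[R]_n) : R := \sum_(i < n) `|v i 0|.

Definition l2norm n (v : 'cV[R]_n) : R :=
  Num.sqrt (\sum_(i < n) v i 0 ^+ 2).

End Euclidean.

Section Projector.
Context {R : realType} (n p : nat) (X : 'M[R]_(n, p)) (T : {set 'I_p}).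

(* Subspaces are row spaces in mxalgebra, hence the transposes. *)
Definition span_cols : 'M[R]_n := (\sum_(j in T) <<(col j X)^T>>)%MS.

(* kermx U^T is the set of row vectors orthogonal to the row space of U. *)
Definition orth_proj : 'M[R]_n := (proj_mx span_cols (kermx span_cols^T))^T.

Lemma span_cols_disj : (span_cols :&: kermx span_cols^T)%MS = 0.
Proof.
apply/eqP/rowV0P => v; rewrite sub_capmx => /andP[/submxP[w wE] /sub_kermxP vU].
have : v *m v^T = 0 by rewrite [in X in _ *m X]wE trmx_mul mulmxA vU mul0mx.
move=> /matrixP/(_ 0 0); rewrite !mxE => /eqP.
rewrite psumr_eq0; last by move=> i _; rewrite mxE -expr2 sqr_ge0.
move=> /allP v0; apply/rowP => i; rewrite mxE.
have := v0 i (mem_index_enum i); rewrite mxE -expr2 sqrf_eq0.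
by move/eqP.
Qed.

Lemma span_cols_full m (W : 'M[R]_(m, n)) :
  (W <= span_cols + kermx span_cols^T)%MS.
Proof.
rewrite (submx_trans (submx1 W))// -mxrank_leqif_sup ?submx1//.
rewrite mxrank1 mxrank_disjoint_sum ?span_cols_disj//.
by rewrite mxrank_ker mxrank_tr subnKC// rank_leq_col.
Qed.

Lemma orth_proj_span (v : 'cV[R]_n) :
  exists c : 'I_p -> R, orth_proj *m v = \sum_(j in T) c j *: col j X.
Proof.
have : ((orth_proj *m v)^T <= span_cols)%MS.
  by rewrite trmx_mul trmxK proj_mx_sub.
move=> /sub_sumsmxP[u uE].
have uj j : exists c, u j *m <<(col j X)^T>>%MS = c *: (col j X)^T.
  by apply/sub_rVP; rewrite (submx_trans (submxMl _ _)) ?genmxE.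
exists (fun j => sval (cid (uj j))).
apply: trmx_inj; rewrite uE raddf_sum/=; apply: eq_bigr => j _.
by rewrite linearZ/=; case: cid.
Qed.

Lemma orth_proj_orth (v : 'cV[R]_n) (j : 'I_p) :
  j \in T -> dot (col j X) (v - orth_proj *m v) = 0.
Proof.
move=> jT.
have /sub_kermxP k0 : ((v - orth_proj *m v)^T <= kermx span_cols^T)%MS.
  by rewrite raddfB/= trmx_mul trmxK proj_mx_compl_sub ?span_cols_full.
have /submxP[w wE] : ((col j X)^T <= span_cols)%MS.
  by rewrite (sumsmx_sup j)// genmxE.
have : (v - orth_proj *m v)^T *m col j X = 0.
  by rewrite -[col j X]trmxK wE trmx_mul mulmxA k0 mul0mx.
move=> /matrixP/(_ 0 0); rewrite !mxE => H; rewrite /dot -[RHS]H.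
by apply: eq_bigr => i _; rewrite ![in RHS]mxE ![in LHS]mxE mulrC.
Qed.

Definition rho : R :=
  (Num.sqrt n%:R)^-1 *
  \big[Num.max/0]_(j < p) l2norm ((1%:M - orth_proj) *m col j X).

End Projector.

Section Lasso.
Context {R : realType} (n p : nat) (X : 'M[R]_(n, p)).

Definition pred_loss (b b' : 'cV[R]_p) : R :=
  n%:R^-1 * l2norm (X *m (b - b')) ^+ 2.

Definition lasso_objective (y : 'cV[R]_n) (lambda : R) (b : 'cV[R]_p) : R :=
  (2 * n%:R)^-1 * l2norm (y - X *m b) ^+ 2 + lambda * l1norm b.

Definition lasso_argmin (y : 'cV[R]_n) (lambda : R) : set 'cV[R]_p :=
  [set b | forall b', lasso_objective y lambda b <= lasso_objective y lambda b'].

End Lasso.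

Section Gaussian.
Context {R : realType} (d : measure_display) (Omega : measurableType d).
Variable P : probability Omega R.

(* The library's normal_prob m 0 is the uniform law on [0, 1], not the point
   mass at m, so the degenerate case is treated apart. *)
Definition gaussian_law (m s : R) : set R -> \bar R :=
  if s == 0 then dirac m else normal_prob m s.

(* xi ~ N_n(mu, Sigma): every linear form <a, xi> has the (possibly degenerate)
   law N(<a, mu>, <a, Sigma a>). *)
Definition gaussian_vector n (xi : Omega -> 'cV[R]_n) (mu : 'cV[R]_n)
    (Sigma : 'M[R]_n) : Prop :=
  (forall i, measurable_fun [set: Omega] (fun w => xi w i 0)) /\
  (forall (a : 'cV[R]_n) (A : set R), measurable A ->
    P [set w | A (dot a (xi w))] =
    gaussian_law (dot a mu) (Num.sqrt (dot a (Sigma *m a))) A).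

(* Since no measurability is required of a selection of minimizers, E may fail
   to be measurable: the bound is on the inner probability of E. *)
Definition prob_at_least (q : R) (E : set Omega) : Prop :=
  exists A : set Omega, [/\ measurable A, A `<=` E & (q%:E <= P A)%E].

Lemma prob_at_leastE (q : R) (E : set Omega) : measurable E ->
  prob_at_least q E <-> (q%:E <= P E)%E.
Proof.
move=> mE; split=> [[A [mA AE qA]]|qE]; last by exists E; split.
by apply: (le_trans qA); apply: le_measure; rewrite ?inE.
Qed.

End Gaussian.

(* Main.v *)
Require Import Defs.
From HB Require Import structures.
From mathcomp Require Import all_boot all_order all_algebra.
From mathcomp Require Import all_classical all_reals all_analysis.
From mathcomp Require Import measurable_realfun ring lra.

Set Implicit Arguments.
Unset Strict Implicit.
Unset Printing Implicit Defensive.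

Import Order.TTheory GRing.Theory Num.Theory.
Import numFieldNormedType.Exports.

Local Open Scope classical_set_scope.
Local Open Scope ring_scope.

(** The argument separates what happens on a fixed realization of the noise
    from the probability that the noise is favourable.

    Realization by realization.  Optimality of the Lasso [h], tested along the
    segment from [h] to a competitor [b], gives the variational inequality
    [lasso_variational].  With [y = X betas + xi] and the polarization identity
    it becomes
      n l(h, betas) + |X(h - b)|^2 - n l(b, betas)
        <= 2 n lambda (|b|_1 - |h|_1) + 2 <xi, X(h - b)>.
    The noise term is split along the projector on the columns in [T]
    ([noise_inner_product_le]).  The projected part costs
    |Pi_T xi|^2 + |X(h - b)|^2, whose second term is absorbed by the left-hand
    side; the residual part is at most
    max_j |<xi, (I - Pi_T) x^j>| |h - b|_1.  So the oracle inequality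
    ([lasso_oracle_inequality]) holds whenever
      |Pi_T xi|^2 <= 2 sigma^2 (|T| + 2 log (1 / delta))  and
      max_j |<xi, (I - Pi_T) x^j>| <= n lambda / gamma.

    Probability.  Each of the two conditions fails with probability at most
    [delta].  For the second one this is a union bound over the [p] columns,
    each residual column having norm at most sqrt n * rho_T; it rests on the
    sharp two-sided tail P(|Z| > t) <= exp (- t^2 / 2) ([normal_tail],
    [gaussian_dot_tail]), since a prefactor 2 would exhaust the allowed failure
    probability.  For the first one, [gram_schmidt] gives [#|T|] pairwise
    orthogonal vectors [e], each of norm 0 or 1, whose span contains the columns
    in [T], so that |Pi_T xi|^2 is at most the sum of the <e, xi>^2.  The
    exponential moment of this sum at 1 / (4 sigma^2) is bounded by induction
    ([chi2_mgf_le]) using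
    exp (z^2 / 4) = E_g exp (g z / sqrt 2) with [g] standard Gaussian: by
    Tonelli, squares of linear forms of [xi] are replaced by linear forms, whose
    laws are exactly what defines a Gaussian vector.  Markov's inequality
    concludes ([chi2_tail]), as sqrt 2 <= exp (1 / 2). *)

(** * Euclidean and l1 norms *)

Section Dot.
Context {R : realType}.

Lemma dotC n (u v : 'cV[R]_n) : dot u v = dot v u.
Proof. by apply: eq_bigr => i _; rewrite mulrC. Qed.

Lemma dotDl n (u v w : 'cV[R]_n) : dot (u + v) w = dot u w + dot v w.
Proof. by rewrite -big_split; apply: eq_bigr => i _; rewrite mxE mulrDl. Qed.

Lemma dotZl n c (u v : 'cV[R]_n) : dot (c *: u) v = c * dot u v.
Proof. by rewrite /dot mulr_sumr; apply: eq_bigr => i _; rewrite mxE mulrA. Qed.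

Lemma dot0l n (v : 'cV[R]_n) : dot 0 v = 0.
Proof. by rewrite -(scale0r v) dotZl mul0r. Qed.

Lemma dotNl n (u v : 'cV[R]_n) : dot (- u) v = - dot u v.
Proof. by rewrite -scaleN1r dotZl mulN1r. Qed.

Lemma dotDr n (u v w : 'cV[R]_n) : dot w (u + v) = dot w u + dot w v.
Proof. by rewrite !(dotC w) dotDl. Qed.

Lemma dotZr n c (u v : 'cV[R]_n) : dot u (c *: v) = c * dot u v.
Proof. by rewrite !(dotC u) dotZl. Qed.

Lemma dotNr n (u v : 'cV[R]_n) : dot u (- v) = - dot u v.
Proof. by rewrite !(dotC u) dotNl. Qed.

Lemma dot_suml n I (s : seq I) (Q : pred I) (F : I -> 'cV[R]_n) v :
  dot (\sum_(i <- s | Q i) F i) v = \sum_(i <- s | Q i) dot (F i) v.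
Proof. by elim/big_rec2: _ => [|i x y _ <-]; rewrite ?dot0l ?dotDl. Qed.

Lemma dot_ge0 n (u : 'cV[R]_n) : 0 <= dot u u.
Proof. by apply: sumr_ge0 => i _; rewrite -expr2 sqr_ge0. Qed.

Lemma dot_eq0 n (u : 'cV[R]_n) : (dot u u == 0) = (u == 0).
Proof.
apply/idP/eqP => [|->]; last by rewrite dot0l.
rewrite psumr_eq0; last by move=> i _; rewrite -expr2 sqr_ge0.
move=> /allP u0; apply/colP => i; rewrite mxE.
by have := u0 i (mem_index_enum i); rewrite -expr2 sqrf_eq0 => /eqP.
Qed.

Lemma sqr_l2norm n (u : 'cV[R]_n) : l2norm u ^+ 2 = dot u u.
Proof.
rewrite sqr_sqrtr; first by apply: eq_bigr => i _; rewrite expr2.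
by apply: sumr_ge0 => i _; rewrite sqr_ge0.
Qed.

Lemma l2norm_ge0 n (u : 'cV[R]_n) : 0 <= l2norm u.
Proof. exact: sqrtr_ge0. Qed.

Lemma l2norm_gt0 n (u : 'cV[R]_n) : u != 0 -> 0 < l2norm u.
Proof.
by move=> u0; rewrite lt0r l2norm_ge0 andbT -sqrf_eq0 sqr_l2norm dot_eq0.
Qed.

Lemma l1normD n (u v : 'cV[R]_n) : l1norm (u + v) <= l1norm u + l1norm v.
Proof. by rewrite -big_split ler_sum// => i _; rewrite mxE ler_normD. Qed.

Lemma l1normZ n c (u : 'cV[R]_n) : l1norm (c *: u) = `|c| * l1norm u.
Proof.
by rewrite [RHS]mulr_sumr; apply: eq_bigr => i _; rewrite mxE normrM.
Qed.

Lemma l1normN n (u : 'cV[R]_n) : l1norm (- u) = l1norm u.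
Proof. by apply: eq_bigr => i _; rewrite mxE normrN. Qed.

End Dot.

(** * The Lasso on a fixed realization of the noise *)

Section LassoDeterministic.
Context {R : realType} (n p : nat) (X : 'M[R]_(n, p)).

(** First-order optimality in subgradient-free form: minimality is tested at
    [h + t (b - h)], where convexity of the l1 norm makes the penalty at most
    affine in [t]; dividing by [t] and letting [t] tend to [0] removes the
    quadratic term. *)
Lemma lasso_variational (y : 'cV[R]_n) (lambda : R) (h b : 'cV[R]_p) :
  (0 < n)%N -> 0 <= lambda -> lasso_argmin X y lambda h ->
  dot (X *m (b - h)) (y - X *m h) <= n%:R * lambda * (l1norm b - l1norm h).
Proof.
move=> n0 l0 hmin.
have n0' : (0 : R) < n%:R by rewrite ltr0n.
set r := y - X *m h; set u := X *m (b - h).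
have key t : 0 < t -> t <= 1 ->
    dot u r <= n%:R * lambda * (l1norm b - l1norm h) + t * dot u u.
  move=> t0 t1; have := hmin (h + t *: (b - h)).
  rewrite /lasso_objective !sqr_l2norm mulmxDr -scalemxAr -/u opprD addrA -/r.
  have l1 : l1norm (h + t *: (b - h)) <= (1 - t) * l1norm h + t * l1norm b.
    have -> : h + t *: (b - h) = (1 - t) *: h + t *: b.
      by apply/colP => i; rewrite !mxE; ring.
    apply: (le_trans (l1normD _ _)).
    by rewrite !l1normZ ger0_norm ?subr_ge0// ger0_norm// ltW.
  have -> : dot (r - t *: u) (r - t *: u) =
      dot r r - 2 * t * dot u r + t ^+ 2 * dot u u.
    move: (r) (u) => r' u'.
    by rewrite !(dotDl, dotDr, dotNl, dotNr, dotZl, dotZr) (dotC r' u'); ring.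
  have c0 := dot_ge0 u; move/(ler_wpM2l l0): l1 => l1 le_obj.
  have {le_obj}le1 : (2 * n%:R)^-1 * (2 * t * dot u r - t ^+ 2 * dot u u) <=
     t * (lambda * (l1norm b - l1norm h)) by nra.
  rewrite ler_pdivrMl in le1; last by rewrite mulr_gt0.
  rewrite -(ler_pM2l t0); nra.
(* this [t] lies in ]0, 1] and makes the quadratic term at most [e] *)
apply/ler_addgt0Pr => e e0.
have c1 : 0 < dot u u + 1 by rewrite ltr_wpDl// dot_ge0.
have /key/(_ _) : 0 < Num.min 1 (e / (dot u u + 1)).
  by rewrite lt_min ltr01 divr_gt0.
move=> /(_ ltac:(by rewrite ge_min lexx))/le_trans; apply.
rewrite lerD2l; apply: (@le_trans _ _ (e / (dot u u + 1) * dot u u)).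
  by rewrite ler_wpM2r ?dot_ge0// ge_min lexx orbT.
by rewrite mulrAC ler_pdivrMr// ler_pM2l// lerDl.
Qed.

(** With [w] the projection of [X b], <w, xi> is a sum over [es] of the products
    <e, w><e, xi>, bounded by 2xy <= x^2 + y^2, and |w| <= |X b|; the residual
    X b - w is the combination of the residual columns with coefficients [b].
    The identity |w|^2 = sum <e, w>^2 comes from pairing the expansion of [w]
    with [w] itself. *)
Lemma noise_inner_product_le (T : {set 'I_p}) (es : seq 'cV[R]_n)
    (xi : 'cV[R]_n) (M : R) (b : 'cV[R]_p) :
  (forall j, j \in T -> col j X = \sum_(e <- es) dot e (col j X) *: e) ->
  (forall j, `|dot ((1%:M - orth_proj X T) *m col j X) xi| <= M) ->
  2 * dot (X *m b) xi <=
    \sum_(e <- es) dot e xi ^+ 2 + dot (X *m b) (X *m b) + 2 * M * l1norm b.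
Proof.
move=> esX Mbound.
have Xb : X *m b = \sum_j b j 0 *: col j X.
  apply/colP => i; rewrite mxE summxE; apply: eq_bigr => j _.
  by rewrite !mxE mulrC.
have [c wE] := orth_proj_span X T (X *m b).
set w := orth_proj X T *m (X *m b) in wE.
have w_es : w = \sum_(e <- es) dot e w *: e.
  transitivity (\sum_(j in T) \sum_(e <- es) dot e (c j *: col j X) *: e).
    rewrite wE; apply: eq_bigr => j jT; rewrite {1}(esX j jT) scaler_sumr.
    by apply: eq_bigr => e _; rewrite dotZr scalerA.
  rewrite exchange_big; apply: eq_bigr => e _.
  rewrite -scaler_suml dotC wE dot_suml; congr (_ *: _).
  by apply: eq_bigr => j _; rewrite dotC.
have w_sq : dot w w = \sum_(e <- es) dot e w ^+ 2.
  rewrite {1}w_es dot_suml; apply: eq_bigr => e _.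
  by rewrite dotZl expr2.
have w_orth : dot w (X *m b - w) = 0.
  rewrite {1}wE dot_suml big1// => j jT.
  by rewrite dotZl orth_proj_orth// mulr0.
have w_le : dot w w <= dot (X *m b) (X *m b).
  have := dot_ge0 (X *m b - w); move: w_orth.
  rewrite !(dotDl, dotDr, dotNl, dotNr) (dotC _ w); lra.
have fit : 2 * dot w xi <= \sum_(e <- es) dot e xi ^+ 2 + dot w w.
  rewrite {1}w_es dot_suml w_sq -big_split mulr_sumr ler_sum// => e _.
  by rewrite dotZl/=; have := sqr_ge0 (dot e xi - dot e w); rewrite !expr2; lra.
have rest : dot (X *m b - w) xi <= M * l1norm b.
  have -> : X *m b - w = \sum_j b j 0 *: ((1%:M - orth_proj X T) *m col j X).
    rewrite -[X *m b in LHS]mul1mx -mulmxBl {1}Xb mulmx_sumr.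
    by apply: eq_bigr => j _; rewrite scalemxAr.
  rewrite dot_suml mulr_sumr ler_sum// => j _; rewrite dotZl.
  by rewrite (le_trans (ler_norm _))// normrM mulrC ler_wpM2r.
rewrite dotDl dotNl in rest; lra.
Qed.

(** The value [n lambda / gamma] for the residual noise turns the penalty
    difference |b|_1 - |h|_1 into (1 + 1/gamma)|b|_1 - (1 - 1/gamma)|h|_1, by
    the triangle inequality for |h - b|_1. *)
Lemma lasso_oracle_inequality (T : {set 'I_p}) (es : seq 'cV[R]_n)
    (xi : 'cV[R]_n) (betas h b : 'cV[R]_p) (lambda gamma q : R) :
  (0 < n)%N -> 0 <= lambda -> 1 <= gamma ->
  lasso_argmin X (X *m betas + xi) lambda h ->
  (forall j, j \in T -> col j X = \sum_(e <- es) dot e (col j X) *: e) ->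
  (forall j, `|dot ((1%:M - orth_proj X T) *m col j X) xi| <=
     n%:R * lambda / gamma) ->
  \sum_(e <- es) dot e xi ^+ 2 <= q ->
  pred_loss X h betas + 2 * (gamma - 1) * lambda / gamma * l1norm h <=
  pred_loss X b betas + 2 * (gamma + 1) * lambda / gamma * l1norm b + q / n%:R.
Proof.
move=> n0 l0 g1 hmin esX Mbound qbound.
have n0' : (0 : R) < n%:R by rewrite ltr0n.
have g0 : 0 < gamma by lra.
have := lasso_variational b n0 l0 hmin.
have := noise_inner_product_le (h - b) esX Mbound.
have hb : l1norm (h - b) <= l1norm h + l1norm b.
  by rewrite -(l1normN b) l1normD.
have {hb} : n%:R * lambda / gamma * l1norm (h - b) <=
    n%:R * lambda / gamma * (l1norm h + l1norm b).
  by rewrite ler_wpM2l// divr_ge0 ?mulr_ge0 ?(ltW g0).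
move: (l1norm (h - b)) => l1hb.
rewrite /pred_loss !sqr_l2norm !mulmxBr.
set A := X *m b; set B := X *m h; set C := X *m betas.
rewrite !(dotDl, dotDr, dotNl, dotNr) (dotC B A) (dotC C A) (dotC C B).
move: (dot A A) (dot B B) (dot C C) (dot A B) (dot A C) (dot B C) (dot A xi)
  (dot B xi) => AA BB CC AB AC BC Ax Bx l1le noise var.
rewrite -(ler_pM2l n0').
set L := n%:R * lambda / gamma in l1le noise.
have nlE : n%:R * lambda = L * gamma by rewrite /L divfK// gt_eqF.
have E1 c x : n%:R * (n%:R^-1 * x + 2 * c * lambda / gamma * l1norm h) =
   x + 2 * c * L * l1norm h.
  by rewrite /L; field; rewrite ?gt_eqF.
have E2 c x :
   n%:R * (n%:R^-1 * x + 2 * c * lambda / gamma * l1norm b + q / n%:R) =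
   x + 2 * c * L * l1norm b + q.
  by rewrite /L; field; rewrite ?gt_eqF.
rewrite E1 E2; rewrite nlE in var.
move: (L) (l1norm h) (l1norm b) (\sum_(e <- es) dot e xi ^+ 2)
  var noise l1le qbound => L' lh lb Q; lra.
Qed.

End LassoDeterministic.

(** * Orthonormalization *)

Section GramSchmidt.
Context {R : realType} (n : nat).
Implicit Types (e v : 'cV[R]_n) (es s : seq 'cV[R]_n).

(** Zero vectors are allowed so that orthonormalizing a list keeps its length,
    whether or not it is linearly independent. *)
Definition orthosystem es : bool :=
  pairwise (fun u v => dot u v == 0) es &&
  all (fun e => (e == 0) || (dot e e == 1)) es.

Lemma orthosystem_cons e es : orthosystem (e :: es) ->
  [/\ forall f, f \in es -> dot e f = 0,
      e = 0 \/ dot e e = 1 & orthosystem es].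
Proof.
rewrite /orthosystem/= => /andP[/andP[/allP eo o] /andP[e01 n01]].
by split; [move=> f /eo/eqP|case/orP: e01 => /eqP; [left|right]|rewrite o].
Qed.

(** Only the term of [f] itself contributes; a repeated vector is orthogonal to
    itself, hence zero. *)
Lemma orthosystem_sum es f v : orthosystem es -> f \in es ->
  \sum_(e <- es) dot e v * dot e f = dot f v.
Proof.
elim: es => // e es IH /orthosystem_cons[eo e01 oes].
rewrite inE big_cons => /predU1P[->|fes]; last first.
  by rewrite (eo f fes) mulr0 add0r IH.
rewrite big1_seq => [|g /andP[_ ges]]; last first.
  by rewrite (dotC g e) (eo g ges) mulr0.
by case: e01 => ->; rewrite ?mulr1 ?addr0// !dot0l mulr0.
Qed.

(** The residual [r] of a new vector is orthogonal to the system already built;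
    when [r] vanishes, the normalized residual is the zero vector. *)
Lemma gram_schmidt s : exists es, [/\ size es = size s, orthosystem es &
  forall v, v \in s -> v = \sum_(e <- es) dot e v *: e].
Proof.
elim: s => [|v s [es [size_es oes es_s]]]; first by exists [::].
pose r := v - \sum_(e <- es) dot e v *: e.
have r_es f : f \in es -> dot r f = 0.
  move=> fes; rewrite dotDl dotNl dot_suml.
  under eq_bigr do rewrite dotZl.
  by rewrite orthosystem_sum// dotC subrr.
have rv : dot r v = dot r r.
  rewrite -[X in dot r X = _](subrK (\sum_(e <- es) dot e v *: e)) -/r dotDr.
  rewrite [X in _ + X]dotC dot_suml big1_seq ?addr0// => e /andP[_ ees].
  by rewrite dotZl (dotC e r) r_es// mulr0.
exists ((l2norm r)^-1 *: r :: es); split => /=; first by rewrite size_es.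
  move: oes; rewrite /orthosystem/= => /andP[-> ->]; rewrite !andbT.
  apply/andP; split.
    by apply/allP => e ees; rewrite dotZl r_es ?mulr0.
  have [->|r0] := eqVneq r 0; first by rewrite scaler0 eqxx.
  rewrite dotZl dotZr -sqr_l2norm; apply/orP; right; apply/eqP.
  by field; rewrite gt_eqF// l2norm_gt0.
move=> u; rewrite inE big_cons dotZl => /predU1P[->|us].
  rewrite rv scalerA; apply/eqP; rewrite -subr_eq; apply/eqP.
  rewrite -/r; have [->|r0] := eqVneq r 0; first by rewrite scaler0.
  rewrite -[LHS]scale1r; congr (_ *: _); rewrite -sqr_l2norm.
  by field; rewrite gt_eqF// l2norm_gt0.
suff -> : dot r u = 0 by rewrite mulr0 scale0r add0r -es_s.
rewrite (es_s u us) dotC dot_suml big1_seq// => e /andP[_ ees].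
by rewrite dotZl (dotC e r) r_es// mulr0.
Qed.

End GramSchmidt.

(** * The one-dimensional normal law *)

Section Normal.
Context {R : realType}.
Local Notation mu := (@lebesgue_measure R).

(** The density is almost everywhere the Radon-Nikodym derivative of the normal
    law, for which the change of measure is known. *)
Lemma integral_normal_prob (m s : R) (f : R -> \bar R) :
  measurable_fun [set: R] f -> (forall x, 0 <= f x)%E ->
  (\int[normal_prob m s]_x f x = \int[mu]_x (f x * (normal_pdf m s x)%:E))%E.
Proof.
move=> mf f0; have numu := normal_prob_dominates m s.
rewrite -(Radon_Nikodym_SigmaFinite.change_of_variables numu)//.
apply: ae_eq_integral => //.
- apply: emeasurable_funM => //; apply: (measurable_int mu).
  exact: Radon_Nikodym_SigmaFinite.f_integrable.
- apply: emeasurable_funM => //; apply/measurable_EFinP.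
  exact: measurable_normal_pdf.
- apply: ae_eqe_mul2l; apply: integral_ae_eq => //=.
  + exact: Radon_Nikodym_SigmaFinite.f_integrable.
  + by apply/measurable_EFinP; exact: measurable_normal_pdf.
  + by move=> E _ mE; rewrite -Radon_Nikodym_SigmaFinite.f_integral.
Qed.

(** Exponential tilting moves the mean: completing the square, the integrand is
    a constant multiple of the density with mean [a s^2]. *)
Lemma normal_mgf (s a : R) : s != 0 ->
  (\int[normal_prob 0 s]_x (expR (a * x))%:E =
   (expR (a ^+ 2 * s ^+ 2 / 2))%:E)%E.
Proof.
move=> s0; rewrite integral_normal_prob; last 2 first.
- by apply/measurable_EFinP/measurableT_comp => //; exact: measurable_funM.
- by move=> x; rewrite lee_fin expR_ge0.
transitivity (\int[mu]_x ((expR (a ^+ 2 * s ^+ 2 / 2))%:E *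
    (normal_pdf (a * s ^+ 2) s x)%:E))%E.
  apply: eq_integral => x _; rewrite -!EFinM !normal_pdfE//; congr EFin.
  rewrite mulrCA [RHS]mulrCA; congr (_ * _).
  rewrite /normal_fun -!expRD; congr expR; by field; exact: s0.
rewrite ge0_integralZl//=.
- by rewrite integral_normal_pdf mule1.
- by apply/measurable_EFinP; exact: measurable_normal_pdf.
- by move=> x _; rewrite lee_fin normal_pdf_ge0.
Qed.

(** The integrand is a constant multiple of the density with variance 2. *)
Lemma normal_mgf_sqr :
  (\int[normal_prob 0 1]_x (expR (x ^+ 2 / 4))%:E = (Num.sqrt 2 : R)%:E)%E.
Proof.
rewrite integral_normal_prob; last 2 first.
- apply/measurable_EFinP/measurableT_comp => //.
  by apply: measurable_funM => //; exact: measurable_funX.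
- by move=> x; rewrite lee_fin expR_ge0.
have s2 : Num.sqrt 2 != 0 :> R by rewrite sqrtr_eq0 -ltNge.
transitivity (\int[mu]_x ((Num.sqrt 2)%:E *
    (normal_pdf 0 (Num.sqrt 2) x)%:E))%E.
  apply: eq_integral => x _; rewrite -!EFinM !normal_pdfE ?oner_neq0//.
  congr EFin; rewrite mulrCA [RHS]mulrA; congr (_ * _).
    rewrite /normal_peak sqr_sqrtr// expr1n mul1r -mulrnAr sqrtrM// invfM.
    by rewrite mulrA divff// mul1r.
  rewrite /normal_fun -!expRD sqr_sqrtr//; congr expR; rewrite expr1n; by field.
rewrite ge0_integralZl//=.
- by rewrite integral_normal_pdf mule1.
- by apply/measurable_EFinP; exact: measurable_normal_pdf.
- by move=> x _; rewrite lee_fin normal_pdf_ge0.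
Qed.

(** The reflection [x |-> 2 m - x] preserves the density and exchanges the two
    half-lines. *)
Lemma normal_prob_above_mean (m s : R) : s != 0 ->
  (normal_prob m s `]m, +oo[ <= (2^-1)%:E)%E.
Proof.
move=> s0.
have sym : normal_prob m s `]-oo, m] = normal_prob m s `[m, +oo[.
  rewrite /normal_prob.
  pose F (x : R) := 2 * m - x.
  have F1 : F^`()%classic = cst (-1).
    apply/funext => x.
    by rewrite derive1E /F deriveB// derive_cst derive_id sub0r.
  have Fm : F m = m by rewrite /F; ring.
  rewrite -{1}Fm decreasing_ge0_integration_by_substitutiony//.
  - apply: eq_integral => x _; congr EFin; rewrite F1 !fctE opprK mulr1.
    rewrite !normal_pdfE//; congr (_ * expR _).
    rewrite /F; by field; exact: s0.
  - by move=> x y _ _ /= xy; rewrite /F; lra.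
  - by rewrite F1 => ? _; exact: cst_continuous.
  - by rewrite F1; exact: is_cvg_cst.
  - by rewrite F1; exact: is_cvg_cst.
  - split=> //.
    apply: cvg_at_right_filter; rewrite /F.
    by apply: cvgB; [exact: cvg_cst|exact: cvg_id].
  - apply/cvgrNyPle => A; near=> x; rewrite /F lerBlDr -lerBlDl; near: x.
    by apply: nbhs_pinfty_ge; exact: num_real.
  - apply: continuous_subspaceT; exact: continuous_normal_pdf.
  - by move=> x _; exact: normal_pdf_ge0.
have tot : (normal_prob m s `]-oo, m] + normal_prob m s `]m, +oo[ <= 1)%E.
  rewrite -measureU//; first by apply: probability_le1; exact: measurableU.
  apply/seteqP; split=> // x []/=; rewrite !in_itv/= andbT; lra.
have le_open : (normal_prob m s `]m, +oo[ <= normal_prob m s `[m, +oo[)%E.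
  apply: le_measure; rewrite ?inE//.
  by move=> x/=; rewrite !in_itv/= !andbT; exact: ltW.
have : (normal_prob m s `]m, +oo[ + normal_prob m s `]m, +oo[ <= 1)%E.
  by apply: le_trans tot; rewrite leeD2r// sym.
have : normal_prob m s `]m, +oo[ \is a fin_num by exact: fin_num_measure.
case: (normal_prob m s `]m, +oo[) => // q _.
rewrite -EFinD !lee_fin; lra.
Unshelve. all: by end_near. Qed.

(** For [x >= t >= 0] one has x^2 >= t^2 + (x - t)^2, so beyond [t] the density
    with mean 0 is at most exp (- t^2 / (2 s^2)) times the density with mean
    [t], and half of the mass of the latter lies beyond [t]. *)
Lemma normal_tail (s t : R) : s != 0 -> 0 <= t ->
  (normal_prob 0 s `]t, +oo[ <= (expR (- t ^+ 2 / (2 * s ^+ 2)) / 2)%:E)%E.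
Proof.
move=> s0 t0.
have s2 : 0 < s ^+ 2 by rewrite exprn_even_gt0.
apply: (@le_trans _ _ ((expR (- t ^+ 2 / (2 * s ^+ 2)))%:E *
    normal_prob t s `]t, +oo[)%E); last first.
  by rewrite EFinM lee_wpmul2l ?lee_fin ?expR_ge0// normal_prob_above_mean.
rewrite /normal_prob -ge0_integralZl//=; last 2 first.
- apply: measurable_funTS; apply/measurable_EFinP; exact: measurable_normal_pdf.
- by move=> x _; rewrite lee_fin normal_pdf_ge0.
apply: ge0_le_integral => //=.
- by move=> x _; rewrite lee_fin normal_pdf_ge0.
- apply: measurable_funTS; apply/measurable_EFinP; exact: measurable_normal_pdf.
- apply/measurable_funTS/measurable_EFinP; apply: measurable_funM => //.
  exact: measurable_normal_pdf.
move=> x; rewrite in_itv/= andbT => tx; rewrite -EFinM lee_fin !normal_pdfE//.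
rewrite mulrCA ler_wpM2l ?normal_peak_ge0// /normal_fun -expRD ler_expR.
rewrite -mulr_natl -mulrDl ler_wpM2r//.
  by rewrite invr_ge0 pmulr_rge0 ?sqr_ge0.
have : 0 <= t * (x - t) by rewrite mulr_ge0 // subr_ge0 ltW.
rewrite subr0 !expr2; lra.
Qed.

End Normal.

(** * Events *)

Section Events.
Context {R : realType} (d : measure_display) (Omega : measurableType d).

Lemma measurable_superlevel (f : Omega -> R) (t : R) :
  measurable_fun [set: Omega] f ->
  measurable [set w | t < f w] /\ measurable [set w | t <= f w].
Proof.
move=> mf; split; rewrite -[X in measurable X]setTI.
- rewrite (_ : [set w | _] = f @^-1` `]t, +oo[); first exact: mf.
  by apply/seteqP; split => w /=; rewrite in_itv/= andbT.
- rewrite (_ : [set w | _] = f @^-1` `[t, +oo[); first exact: mf.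
  by apply/seteqP; split => w /=; rewrite in_itv/= andbT.
Qed.

Lemma union_bound (P : probability Omega R) (I : Type) (s : seq I)
    (B : I -> set Omega) (q : R) :
  (forall i, measurable (B i)) -> (forall i, P (B i) <= q%:E)%E ->
  (P (\big[setU/set0]_(i <- s) B i) <= (q *+ size s)%:E)%E.
Proof.
move=> mB PB; elim: s => [|i s IH]; first by rewrite big_nil measure0.
rewrite big_cons /= mulrS EFinD; apply: le_trans (measureU2 _ _ _) _ => //.
  exact: bigsetU_measurable.
exact: (leeD (PB i) IH).
Qed.

End Events.

(** * Concentration of Gaussian vectors *)

Section GaussianVector.
Context {R : realType} (d : measure_display) (Omega : measurableType d).
Context (P : probability Omega R) (n : nat) (xi : Omega -> 'cV[R]_n).
Context (sigma : R) (sigma_gt0 : 0 < sigma)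
  (hxi : gaussian_vector P xi 0 (sigma ^+ 2)%:M).

Lemma measurable_dot (a : 'cV[R]_n) :
  measurable_fun [set: Omega] (fun w => dot a (xi w)).
Proof.
rewrite /dot; apply: measurable_sum => i.
by apply: measurable_funM => //; exact: (hxi.1 i).
Qed.

Lemma gaussian_dot_law (a : 'cV[R]_n) (A : set R) : a != 0 -> measurable A ->
  P [set w | A (dot a (xi w))] = normal_prob 0 (sigma * l2norm a) A.
Proof.
move=> a0 mA; rewrite hxi.2// mul_scalar_mx dotZr dotC dot0l -sqr_l2norm.
rewrite -exprMn sqrtr_sqr ger0_norm ?mulr_ge0 ?l2norm_ge0 ?(ltW sigma_gt0)//.
by rewrite /gaussian_law mulf_eq0 !gt_eqF// l2norm_gt0.
Qed.

Lemma gaussian_dot_mgf (a : 'cV[R]_n) :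
  (\int[P]_w (expR (dot a (xi w)))%:E =
   (expR (sigma ^+ 2 * dot a a / 2))%:E)%E.
Proof.
have [->|a0] := eqVneq a 0.
  under eq_integral do rewrite dot0l expR0.
  rewrite integral_cst// mul1e dot0l mulr0 mul0r expR0.
  exact: probability_setT.
have s0 : sigma * l2norm a != 0 by rewrite gt_eqF// mulr_gt0// l2norm_gt0.
rewrite -sqr_l2norm -exprMn; have := normal_mgf 1 s0.
rewrite expr1n mul1r => <-; under [RHS]eq_integral do rewrite mul1r.
pose Z w : measurableTypeR R := dot a (xi w).
transitivity (\int[pushforward P Z]_x (expR x)%:E)%E.
  rewrite ge0_integral_pushforward//=; first exact: measurable_dot.
  by apply/measurable_EFinP; exact: measurable_expR.
apply: eq_measure_integral => /=; first exact: measurable_dot.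
by move=> md A mA _; exact: (gaussian_dot_law a0 mA).
Qed.

(** The linear term in [a] makes the induction work: the square attached to the
    head [e] is linearized as
      exp (<e, xi>^2 / (4 sigma^2)) = E_g exp (c g <e, xi>),
      c = 1 / (sqrt 2 sigma), g standard Gaussian,
    which after exchanging the expectations replaces [a] by [a + c g e], still
    orthogonal to the tail.  Averaging exp (g^2 / 4) over [g] then produces one
    factor sqrt 2. *)
Lemma chi2_mgf_le (es : seq 'cV[R]_n) (a : 'cV[R]_n) : orthosystem es ->
  (forall e, e \in es -> dot e a = 0) ->
  (\int[P]_w (expR (dot a (xi w) +
      \sum_(e <- es) dot e (xi w) ^+ 2 / (4 * sigma ^+ 2)))%:E <=
   (Num.sqrt 2 ^+ size es * expR (sigma ^+ 2 * dot a a / 2))%:E)%E.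
Proof.
elim: es a => [|e es IH] a; first move=> _ _.
  under eq_integral do rewrite big_nil addr0.
  by rewrite gaussian_dot_mgf mul1r.
move=> /orthosystem_cons[eo e01 oes] a_es.
have ea : dot e a = 0 by apply: a_es; rewrite mem_head.
pose c : R := (Num.sqrt 2 * sigma)^-1.
have c2 : c ^+ 2 = (2 * sigma ^+ 2)^-1.
  by rewrite /c exprVn exprMn sqr_sqrtr.
pose S w := \sum_(e <- es) dot e (xi w) ^+ 2 / (4 * sigma ^+ 2).
have mS : measurable_fun setT S.
  rewrite /S; apply: measurable_sum => f; apply: measurable_funM => //.
  by apply: measurable_funX; exact: measurable_dot.
pose f (z : Omega * measurableTypeR R) : \bar R :=
  (expR (dot (a + (c * z.2) *: e) (xi z.1) + S z.1))%:E.
have mf : measurable_fun setT f.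
  apply/measurable_EFinP/measurableT_comp => //.
  apply: measurable_funD; last exact: (measurableT_comp mS).
  under eq_fun do rewrite dotDl dotZl.
  apply: measurable_funD.
    by apply: (measurableT_comp (measurable_dot a)).
  apply: measurable_funM; first exact: measurable_funM.
  by apply: (measurableT_comp (measurable_dot e)).
have f0 z : (0 <= f z)%E by rewrite lee_fin expR_ge0.
rewrite [leLHS](_ : _ = \int[P]_w \int[normal_prob 0 1]_g f (w, g))%E;
  last first.
  apply: eq_integral => w _.
  transitivity (\int[normal_prob 0 1]_g ((expR (dot a (xi w) + S w))%:E *
      (expR ((c * dot e (xi w)) * g))%:E))%E; last first.
    apply: eq_integral => g _; rewrite /f/= dotDl dotZl -EFinM -expRD.
    by congr (expR _)%:E; ring.
  rewrite ge0_integralZl//=; last first.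
    by apply/measurable_EFinP/measurableT_comp => //; exact: measurable_funM.
  rewrite normal_mgf ?oner_neq0// -EFinM -expRD big_cons exprMn c2.
  by congr (expR _)%:E; rewrite -/(S w); field; rewrite gt_eqF.
rewrite fubini_tonelli//=.
have e_le1 : dot e e <= 1 by case: e01 => ->; rewrite ?dot0l.
pose K := Num.sqrt 2 ^+ size es * expR (sigma ^+ 2 * dot a a / 2).
have K0 : 0 <= K by rewrite mulr_ge0 ?exprn_ge0 ?sqrtr_ge0 ?expR_ge0.
apply: (@le_trans _ _
    (\int[normal_prob 0 1]_g (K%:E * (expR (g ^+ 2 / 4))%:E))%E).
  apply: ge0_le_integral => //=.
  - by move=> g _; apply: integral_ge0 => w _; exact: f0.
  - exact: measurable_fun_fubini_tonelli_G.
  - apply/measurable_EFinP/measurable_funM => //; apply: measurableT_comp => //.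
    by apply: measurable_funM => //; exact: measurable_funX.
  move=> g _; have ag_es h : h \in es -> dot h (a + (c * g) *: e) = 0.
    move=> hes; rewrite dotDr dotZr a_es ?inE ?hes ?orbT//.
    by rewrite (dotC h e) eo// mulr0 addr0.
  apply: (le_trans (IH (a + (c * g) *: e) oes ag_es)).
  rewrite -EFinM lee_fin /K -[leRHS]mulrA ler_wpM2l ?exprn_ge0 ?sqrtr_ge0//.
  rewrite -expRD ler_expR !(dotDl, dotDr, dotZl, dotZr) (dotC a) ea.
  have -> : sigma ^+ 2 * dot a a / 2 + g ^+ 2 / 4 =
      sigma ^+ 2 * (dot a a + (c * g) ^+ 2) / 2.
    by rewrite exprMn c2; field; rewrite gt_eqF.
  rewrite ler_wpM2r// ler_wpM2l ?sqr_ge0//.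
  by rewrite !mulr0 addr0 add0r lerD2l mulrA -expr2 ler_piMr ?sqr_ge0.
rewrite ge0_integralZl//=; last first.
  apply/measurable_EFinP/measurableT_comp => //.
  by apply: measurable_funM => //; exact: measurable_funX.
rewrite normal_mgf_sqr -EFinM lee_fin /K /= (exprSr (Num.sqrt 2)) le_eqVlt.
by apply/orP; left; apply/eqP; ring.
Qed.

(** Chernoff's bound at the exponent 1 / (4 sigma^2): the threshold contributes
    exp (- k / 2 - L) and the exponential moment sqrt 2 ^ k <= exp (k / 2). *)
Lemma chi2_tail (es : seq 'cV[R]_n) (L : R) : orthosystem es ->
  (P [set w | 2 * sigma ^+ 2 * ((size es)%:R + 2 * L) <=
              \sum_(e <- es) dot e (xi w) ^+ 2]%R <= (expR (- L))%:E)%E.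
Proof.
move=> oes; pose Q w := \sum_(e <- es) dot e (xi w) ^+ 2.
have mQ : measurable_fun setT Q.
  rewrite /Q; apply: measurable_sum => f.
  by apply: measurable_funX; exact: measurable_dot.
pose X : {RV P >-> R} := mfun_Sub (mem_set mQ).
have s2 : 0 < sigma ^+ 2 by rewrite exprn_gt0.
have r0 : 0 < (4 * sigma ^+ 2)^-1 by rewrite invr_gt0 mulr_gt0.
apply: le_trans (chernoff X _ r0) _.
have -> : 'M_P X (4 * sigma ^+ 2)^-1 =
    (\int[P]_w (expR (dot 0 (xi w) +
      \sum_(e <- es) dot e (xi w) ^+ 2 / (4 * sigma ^+ 2)))%:E)%E.
  rewrite /mmt_gen_fun [in LHS]unlock; apply: eq_integral => w _.
  by rewrite /= dot0l add0r /Q -mulr_suml mulrC.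
have es0 e : e \in es -> dot e (0 : 'cV[R]_n) = 0 by rewrite dotC dot0l.
apply: le_trans (lee_wpmul2r _ (chi2_mgf_le oes es0)) _.
  by rewrite lee_fin expR_ge0.
have -> : (4 * sigma ^+ 2)^-1 * (2 * sigma ^+ 2 * ((size es)%:R + 2 * L)) =
    (size es)%:R * 2^-1 + L.
  by field; rewrite gt_eqF.
rewrite dot0l mulr0 mul0r expR0 mulr1 -EFinM lee_fin opprD expRD mulrA.
rewrite ler_piMl ?expR_ge0// expRN ler_pdivrMr ?expR_gt0// mul1r.
rewrite mulrC expRM_natr lerXn2r ?nnegrE ?sqrtr_ge0 ?expR_ge0//.
rewrite -(ler_pXn2r (n := 2)) ?nnegrE ?sqrtr_ge0 ?expR_ge0// sqr_sqrtr//.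
have := expR_ge1Dx (2^-1 : R); nra.
Qed.

(** Each of the events <a, xi> > t and <-a, xi> > t has probability at most
    half the bound.  The condition on [t] is multiplicative in |a| so as to
    cover [a = 0], where the linear form is identically zero. *)
Lemma gaussian_dot_tail (a : 'cV[R]_n) (t L : R) : 0 < t -> 0 <= L ->
  sigma * l2norm a * Num.sqrt (2 * L) <= t ->
  (P [set w | t < `|dot a (xi w)|]%R <= (expR (- L))%:E)%E.
Proof.
move=> t0 L0 tL; have [->|a0] := eqVneq a 0.
  rewrite [X in P X](_ : _ = set0) ?measure0 ?lee_fin ?expR_ge0//.
  by apply/seteqP; split => // w /=; rewrite dot0l normr0; lra.
set s := sigma * l2norm a in tL.
have s0 : 0 < s by rewrite mulr_gt0// l2norm_gt0.
pose u := expR (- t ^+ 2 / (2 * s ^+ 2)).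
have uL : u <= expR (- L).
  rewrite ler_expR mulNr lerN2 ler_pdivlMr ?mulr_gt0 ?exprn_gt0 ?l2norm_gt0//.
  have -> : L * (2 * s ^+ 2) = (s * Num.sqrt (2 * L)) ^+ 2.
    by rewrite [RHS]exprMn sqr_sqrtr ?mulr_ge0//; ring.
  by rewrite lerXn2r// nnegrE ?mulr_ge0 ?sqrtr_ge0// ltW.
apply: (@le_trans _ _ u%:E); last by rewrite lee_fin.
have half (b : 'cV[R]_n) : b != 0 -> l2norm b = l2norm a ->
    (P [set w | t < dot b (xi w)]%R <= (u / 2)%:E)%E.
  move=> b0 ba.
  have -> : [set w | t < dot b (xi w)] =
      [set w | `]t, +oo[%classic (dot b (xi w))].
    by apply/seteqP; split => w /=; rewrite in_itv/= andbT.
  rewrite gaussian_dot_law// /u /s -ba; apply: normal_tail (ltW t0).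
  by rewrite mulf_neq0// gt_eqF// l2norm_gt0.
have mD (b : 'cV[R]_n) : measurable [set w | t < dot b (xi w)].
  exact: (measurable_superlevel t (measurable_dot b)).1.
have -> : [set w | t < `|dot a (xi w)|] =
    [set w | t < dot a (xi w)] `|` [set w | t < dot (- a) (xi w)].
  by apply/seteqP; split => w /=; rewrite ltr_normr dotNl => /orP.
apply: le_trans (measureU2 _ _ _) _ => //.
have -> : u = u / 2 + u / 2 by field.
rewrite EFinD leeD// half ?oppr_eq0//.
by rewrite /l2norm; congr Num.sqrt; apply: eq_bigr => i _; rewrite mxE sqrrN.
Qed.

End GaussianVector.

(** * The oracle inequality *)

Theorem theorem4 (R : realType) (d : measure_display) (Omega : measurableType d)
  (P : probability Omega R) (n p : nat) (n_gt0 : (0 < n)%N) (p_gt0 : (0 < p)%N)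
  (X : 'M[R]_(n, p)) (hX : forall j : 'I_p, l2norm (col j X) ^+ 2 <= n%:R)
  (betas : 'cV[R]_p) (sigma : R) (sigma_gt0 : 0 < sigma)
  (xi y : Omega -> 'cV[R]_n)
  (hxi : gaussian_vector P xi 0 (sigma ^+ 2)%:M)
  (hy : forall w, y w = X *m betas + xi w)
  (T : {set 'I_p}) (delta gamma lambda : R)
  (delta_gt0 : 0 < delta) (gamma_ge1 : 1 <= gamma) (lambda_gt0 : 0 < lambda)
  (hlambda : gamma * sigma * rho X T *
             Num.sqrt (2 * ln (p%:R / delta) / n%:R) <= lambda)
  (betahat : Omega -> 'cV[R]_p)
  (hbetahat : forall w, lasso_argmin X (y w) lambda (betahat w)) :
  prob_at_least P (1 - 2 * delta)
    [set w |
      pred_loss X (betahat w) betas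
        + 2 * (gamma - 1) * lambda / gamma * l1norm (betahat w)
      <= inf [set pred_loss X b betas
                    + 2 * (gamma + 1) * lambda / gamma * l1norm b
             | b in [set: 'cV[R]_p]]
         + 2 * sigma ^+ 2 * (#|T|%:R + 2 * ln (1 / delta)) / n%:R].
Proof.
(* for [delta >= 1/2] the claimed probability is nonpositive; below 1/2 the
   logarithm of [p / delta] is positive *)
have [delta_ge|delta_lt] := leP 2^-1 delta.
  exists set0; split; [exact: measurable0|exact: sub0set|].
  by rewrite measure0 lee_fin; lra.
have n0 : (0 : R) < n%:R by rewrite ltr0n.
have p1 : (1 : R) <= p%:R by rewrite ler1n.
have p0 : (0 : R) < p%:R by lra.
have [es [size_es oes es_span]] := gram_schmidt [seq col j X | j <- enum T].
have esX j : j \in T -> col j X = \sum_(e <- es) dot e (col j X) *: e.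
  by move=> jT; apply: es_span; apply: map_f; rewrite mem_enum.
have {}size_es : size es = #|T| by rewrite size_es size_map cardE.
pose M := n%:R * lambda / gamma.
have M0 : 0 < M by rewrite divr_gt0 ?mulr_gt0//; lra.
pose v j := (1%:M - orth_proj X T) *m col j X.
pose A0 := [set w | 2 * sigma ^+ 2 * ((size es)%:R + 2 * ln (1 / delta)) <=
                    \sum_(e <- es) dot e (xi w) ^+ 2].
pose B0 (j : 'I_p) := [set w | M < `|dot (v j) (xi w)|].
have mA0 : measurable A0.
  apply: (measurable_superlevel _ _).2.
  apply: measurable_sum => e; apply: measurable_funX.
  exact: measurable_dot hxi _.
have mB0 j : measurable (B0 j).
  apply: (measurable_superlevel _ _).1.
  apply: measurableT_comp => //; exact: measurable_dot hxi _.
have PA0 : (P A0 <= delta%:E)%E.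
  apply: le_trans (chi2_tail sigma_gt0 hxi _ oes) _.
  by rewrite lee_fin div1r lnV ?posrE// opprK lnK ?posrE.
have L0 : 0 < ln (p%:R / delta).
  by rewrite ln_gt0// ltr_pdivlMr// mul1r; lra.
(* the residual columns have norm at most [sqrt n * rho X T], the scale at
   which [lambda] is calibrated *)
have v_norm j : sigma * l2norm (v j) * Num.sqrt (2 * ln (p%:R / delta)) <= M.
  have vrho : l2norm (v j) <= Num.sqrt n%:R * rho X T.
    rewrite /rho mulrA divff ?mul1r ?gt_eqF ?sqrtr_gt0//.
    exact: (le_bigmax _ (fun j => l2norm (v j))).
  have -> : M = Num.sqrt n%:R ^+ 2 * lambda / gamma by rewrite sqr_sqrtr ?ler0n.
  move: hlambda; rewrite sqrtrM ?mulr_ge0 ?(ltW L0)// sqrtrV//.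
  have : 0 < Num.sqrt (n%:R : R) by rewrite sqrtr_gt0.
  have := sqrtr_ge0 (2 * ln (p%:R / delta)).
  move: (Num.sqrt _) (Num.sqrt n%:R) vrho => r s vrho r0 s0 hl.
  rewrite ler_pdivlMr; last by lra.
  apply: (@le_trans _ _ (sigma * (s * rho X T) * r * gamma)).
    rewrite ler_wpM2r ?(le_trans ler01)// ler_wpM2r//.
    by rewrite ler_wpM2l// ltW.
  have -> : sigma * (s * rho X T) * r * gamma =
      s ^+ 2 * (gamma * sigma * rho X T * (r / s)) by field; rewrite gt_eqF.
  by rewrite ler_wpM2l ?sqr_ge0.
have PB0 j : (P (B0 j) <= (delta / p%:R)%:E)%E.
  apply: le_trans (gaussian_dot_tail sigma_gt0 hxi M0 (ltW L0) (v_norm j)) _.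
  by rewrite lee_fin expRN lnK ?posrE ?divr_gt0 ?invf_div.
have PB : (P (\big[setU/set0]_(j < p) B0 j) <= delta%:E)%E.
  apply: le_trans (union_bound _ mB0 PB0) _.
  have -> : size (index_enum 'I_p) = p.
    by rewrite [index_enum _]unlock -enumT size_enum_ord.
  by rewrite -(mulr_natr (delta / _)) divfK// gt_eqF.
exists (~` (A0 `|` \big[setU/set0]_(j < p) B0 j)).
have mB : measurable (\big[setU/set0]_(j < p) B0 j).
  by apply: bigsetU_measurable => j _.
have mAB := measurableU _ _ mA0 mB.
split; first exact: measurableC.
  move=> w; rewrite setCU => -[/negP].
  rewrite -ltNge => /ltW Aw Bw/=.
  rewrite -lerBlDr; apply: lb_le_inf.
    by eexists; exists (0 : 'cV[R]_p).
  move=> _ [b _ <-]; rewrite lerBlDr.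
  have hw := hbetahat w; rewrite hy in hw.
  apply: lasso_oracle_inequality n_gt0 (ltW lambda_gt0) gamma_ge1 hw esX _ _.
  - move=> j; rewrite leNgt; apply/negP => Bjw; apply: Bw.
    by rewrite -bigcup_seq; exists j => //=; rewrite mem_index_enum.
  - by rewrite -size_es.
rewrite probability_setC//.
set AB := A0 `|` _ in mAB *.
have PAB : (P AB <= (delta + delta)%:E)%E.
  exact: le_trans (measureU2 _ mA0 mB) (leeD PA0 PB).
have : P AB \is a fin_num by exact: fin_num_measure.
case: (P AB) PAB => // q; rewrite lee_fin => q_le _.
rewrite -[(1 - q%:E)%E]/((1 - q)%:E) lee_fin; lra.
Qed.
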